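(* For every Hausdorff space $X$, $\psi(\mathcal{S}(X))=\psi(X)$.
   Context: For a Hausdorff space $X$, $\mathcal{S}(X)$ is the set of all nonempty subsets of $X$ that are unions of finitely many convergent sequences of $X$, where a convergent sequence is understood as a set $\{x_j:j\in\mathbb{N}\}\cup\{x\}$ with $x_j\to x$ in $X$ (trivial, i.e. constant, sequences allowed). $\mathcal{S}(X)$ carries the Vietoris topology, whose basic open sets are $\langle U_1,\dots,U_r\rangle=\{S\in\mathcal{S}(X): S\subset\bigcup_{i=1}^r U_i \text{ and } S\cap U_j\neq\emptyset \text{ for } 1\le j\le r\}$ with $r\in\mathbb{N}$ and $U_1,\dots,U_r$ open in $X$. The pseudocharacter of a space $Y$ is $\psi(Y)=\sup\{\psi(y,Y):y\in Y\}$, where $\psi(y,Y)=\omega+\min\{|\mathcal{G}|:\mathcal{G}\text{ is a family of open sets of }Y\text{ with }\bigcap\mathcal{G}=\{y\}\}$. *)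

(* Defs.v *)
From HB Require Import structures.
From mathcomp Require Import all_boot.
From mathcomp Require Import boolp classical_sets functions cardinality filter.
From mathcomp Require Import topology.

Set Implicit Arguments.
Unset Strict Implicit.
Unset Printing Implicit Defensive.

Local Open Scope classical_set_scope.
Local Open Scope card_scope.

(* A cardinal number is represented by any set of that cardinality: the order
   of cardinals is [#<=] and the equality of cardinals is [#=]. *)

Definition min_card (T : Type) (F : set (set T)) : set T :=
  xget set0 [set A | F A /\ forall B, F B -> A #<= B].

(* Least upper bound of the cardinals of the members of [F]. Upper bounds are
   sought among the subsets of [T] (which include [setT]); by [sup_card_le] the
   result lies below upper bounds in any other type as well. *)
Definition sup_card (T : Type) (F : set (set T)) : set T :=
  min_card [set K | forall A, F A -> A #<= K].

Section CardinalFacts.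

(* Any family of cardinals has a minimum: take a maximal system of points of
   the product that pairwise differ in every coordinate. *)
Lemma card_le_wf (I : Type) (T : I -> Type) (A : forall i, set (T i)) :
  inhabited I -> exists i, forall j, A i #<= A j.
Proof.
move=> [i0].
pose P : set (set (forall i, T i)) := [set M |
  (forall f, M f -> forall i, A i (f i)) /\
  (forall f g i, M f -> M g -> f i = g i -> f = g)].
have [|M [[MA Minj] Mmax]] := @Zorn_bigcup _ P.
  move=> F FP Ftot; split=> [f [X FX Xf] i|f g i [X FX Xf] [Z FZ Zg]].
    exact: (FP _ FX).1 Xf i.
  have [XZ|ZX] := Ftot _ _ FX FZ.
    exact: (FP _ FZ).2 (XZ _ Xf) Zg.
  exact: (FP _ FX).2 Xf (ZX _ Zg).
have [i Mi] : exists i, forall x, A i x -> exists2 f, M f & f i = x.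
  apply: contrapT => /forallNP nM.
  have {}nM i : exists x, A i x /\ forall f, M f -> f i <> x.
    have /existsNP[x /not_implyP[Ax nx]] := nM i.
    by exists x; split => // f Mf fx; apply: nx; exists f.
  pose h i := sval (cid (nM i)).
  have hA i : A i (h i) by rewrite /h; case: cid => ? [].
  have hM i f : M f -> f i <> h i.
    by rewrite /h; case: cid => ? [? nf] /=; exact: nf.
  apply: (Mmax (M `|` [set h])).
    split=> [f Mf|]; first by left.
    by move=> /(_ h (or_intror erefl)) Mh; exact: (hM i0) Mh _.
  split=> [f [/MA //|->] //|f g j [Mf|->] [Mg|->]] //; first exact: Minj.
  - by move=> /(hM _ _ Mf).
  - by move/esym => /(hM _ _ Mg).
exists i => j.
have MAi : A i = (fun f => f i) @` M.
  by apply/seteqP; split=> [x /Mi[f Mf <-]|_ [f Mf <-]]; [exists f|exact: MA].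
have MAE k : (fun f : forall i, T i => f k) @` M #= M.
  by apply: inj_card_eq => f g /set_mem Mf /set_mem Mg; exact: Minj.
rewrite MAi (card_le_eql (MAE i)) -(card_le_eql (MAE j)).
by apply: subset_card_le => _ [f Mf <-]; exact: MA.
Qed.

Lemma min_cardP (T : Type) (F : set (set T)) : F !=set0 ->
  F (min_card F) /\ forall B, F B -> min_card F #<= B.
Proof.
move=> [A0 FA0].
have [[A FA] Amin] := card_le_wf (fun A : {A | F A} => sval A)
  (inhabits (exist _ A0 FA0)).
rewrite /min_card; case: xgetP => [B _ //|/(_ A)[]].
by split=> // B FB; exact: Amin (exist _ B FB).
Qed.

Lemma sup_cardP (T : Type) (F : set (set T)) :
  (forall A, F A -> A #<= sup_card F) /\
  forall K : set T, (forall A, F A -> A #<= K) -> sup_card F #<= K.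
Proof.
apply: (@min_cardP _ [set K | forall A, F A -> A #<= K]).
by exists setT => A _; exact: card_leT.
Qed.

Lemma sup_card_le (T U : Type) (F : set (set T)) (K : set U) :
  (forall A, F A -> A #<= K) -> sup_card F #<= K.
Proof.
move=> FK.
have [_ supmin] := sup_cardP F.
pose S (b : bool) : Type := if b then U else T.
pose B b : set (S b) :=
  if b is true as b' return set (if b' then U else T) then K else setT.
have [[] /= Bmin] := card_le_wf B (inhabits true); last first.
  exact: card_le_trans (card_leT _) (Bmin true).
have /card_leP[f] := Bmin false.
pose L : set T := range (fun x : K => sval (f x)).
have LK : L #= K.
  rewrite -(card_eqr (card_setT K)); apply: inj_card_eq => x y _ _ /val_inj.
  by apply: inj; rewrite inE.
rewrite -(card_le_eqr LK); apply: supmin => A FA.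
by rewrite (card_le_eqr LK); exact: FK.
Qed.

End CardinalFacts.

Definition omega_plus (T : Type) (A : set T) : set (nat + T) :=
  range inl `|` inr @` A.

Definition local_pseudobase (Y : topologicalType) (y : Y) : set (set (set Y)) :=
  [set G | G `<=` open /\ \bigcap_(U in G) U = [set y]].

Lemma local_pseudobase_neq0 (Y : topologicalType) (y : Y) :
  accessible_space Y -> local_pseudobase y !=set0.
Proof.
move=> Y1; exists [set ~` [set x] | x in ~` [set y]]; split.
  by move=> _ [x _ <-]; apply/closed_openC/accessible_closed_set1.
apply/seteqP; split=> [z zG|_ -> _ [x + <-] yx]; last by apply; rewrite yx.
by apply: contrapT => zy; apply: (zG (~` [set z])) => //; exists z.
Qed.

(* The minimum is attained when [Y] is T1, by [local_pseudobase_neq0] and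
   [min_cardP]. The spaces of interest, Hausdorff spaces and their hyperspaces
   [seq_hyperspace], are T1. *)
Definition pseudocharacter_at (Y : topologicalType) (y : Y) :
    set (nat + set Y) :=
  omega_plus (min_card (local_pseudobase y)).

Definition pseudocharacter (Y : topologicalType) : set (nat + set Y) :=
  sup_card (range (@pseudocharacter_at Y)).
Arguments pseudocharacter : clear implicits.

Section SequenceHyperspace.
Variable X : topologicalType.

Definition convergent_sequence (C : set X) : Prop :=
  exists (u : nat -> X) (x : X), u @ \oo --> x /\ C = range u `|` [set x].

Definition finite_union_of_sequences (S : set X) : Prop :=
  exists F : set (set X), [/\ finite_set F, F `<=` convergent_sequence &
    S = \bigcup_(C in F) C].

Definition seq_hyperspace : Type :=
  {S : set X | S !=set0 /\ finite_union_of_sequences S}.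

HB.instance Definition _ := gen_eqMixin seq_hyperspace.
HB.instance Definition _ := gen_choiceMixin seq_hyperspace.

Definition vietoris_set (Us : seq (set X)) : set seq_hyperspace :=
  [set S | sval S `<=` \bigcup_(U in [set` Us]) U /\
           forall U, U \in Us -> sval S `&` U !=set0].

Let D : set (seq (set X)) := [set Us | [set` Us] `<=` open].

Let vietoris_cover : \bigcup_(Us in D) vietoris_set Us = setT.
Proof.
rewrite -subTset => -[S [S0 SS]] _; exists [:: setT] => /=.
  by move=> U /=; rewrite inE => /eqP ->; exact: openT.
split=> [x Sx|U]; first by exists setT => //=; rewrite inE.
by rewrite inE => /eqP -> /=; rewrite setIT.
Qed.

Let vietoris_join (Us Vs : seq (set X)) (S : seq_hyperspace) :
  D Us -> D Vs -> vietoris_set Us S -> vietoris_set Vs S ->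
  exists Ws, [/\ D Ws, vietoris_set Ws S &
    vietoris_set Ws `<=` vietoris_set Us `&` vietoris_set Vs].
Proof.
move=> DU DV [SU USi] [SV VSi].
pose u := \bigcup_(U in [set` Us]) U; pose v := \bigcup_(V in [set` Vs]) V.
have ou : open u by exact: bigcup_open.
have ov : open v by exact: bigcup_open.
exists ([seq U `&` v | U <- Us] ++ [seq V `&` u | V <- Vs]); split.
- move=> W /=; rewrite mem_cat => /orP[] /mapP[Z ZUs ->].
    by apply: openI => //; exact: DU.
  by apply: openI => //; exact: DV.
- split=> [x Sx|W].
    have [U UUs Ux] := SU _ Sx; exists (U `&` v); last by split => //; exact: SV.
    by rewrite /= mem_cat; apply/orP; left; apply/mapP; exists U.
  rewrite mem_cat => /orP[] /mapP[Z Zs ->].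
    by have [x [Sx Zx]] := USi _ Zs; exists x; do 2?split => //; exact: SV.
  by have [x [Sx Zx]] := VSi _ Zs; exists x; do 2?split => //; exact: SU.
- move=> K [KW WKi].
  have Kuv : sval K `<=` u `&` v.
    move=> x /KW[W /=]; rewrite mem_cat => /orP[] /mapP[Z Zs ->] [Zx ?].
      by split => //; exists Z.
    by split => //; exists Z.
  split; split.
  + by move=> x /Kuv[].
  + move=> U UUs; have [|x [Kx [Ux _]]] := WKi (U `&` v); last by exists x.
    by rewrite mem_cat; apply/orP; left; apply/mapP; exists U.
  + by move=> x /Kuv[].
  + move=> V VVs; have [|x [Kx [Vx _]]] := WKi (V `&` u); last by exists x.
    by rewrite mem_cat; apply/orP; right; apply/mapP; exists V.
Qed.

#[local] HB.instance Definition _ := isPointed.Build (seq (set X)) [::].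
HB.instance Definition _ :=
  isBaseTopological.Build seq_hyperspace vietoris_cover vietoris_join.

End SequenceHyperspace.

(* Main.v *)
Require Import Defs.
From mathcomp Require Import all_boot.
From mathcomp Require Import boolp classical_sets functions cardinality filter.
From mathcomp Require Import topology.

(** The inequality [psi(X) <= psi(S(X))] holds because [x |-> {x}] embeds [X] in
    its hyperspace: shrink each open set around [{x}] to a basic one
    [<U_1, ..., U_r>] and keep the trace [U_1 /\ ... /\ U_r] on [X]
    ([pseudobase_of_singleton]).

    For the converse, let [kappa] be the infinite cardinal [psi(X)] and [S] a
    point of the hyperspace; it is a compact countable set. Let [B] collect, for
    every [y] in [S], a family of at most [kappa] open sets with intersection
    [{y}], and, for every pair of distinct points of [S], two disjoint open sets
    around them; as [S] is countable, [B] has at most [kappa] members. Now [S] is the only [K] such that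
    - [K] is included in every finite union of members of [B] that covers [S]: a
      point [x] outside [S] is missed by some member of [B] around each [y] in
      [S], and finitely many of these cover [S]; so [K] is a subset of [S];
    - [K] meets every finite intersection of members of [B] that meets [S]: if
      [x] in [S] is not in [K], then [K], a compact subset of [S], is covered by
      finitely many members of [B], each disjoint from a member of [B] around
      [x], and the intersection of the latter misses [K].
    This is [local_pseudobase_of_separating]. There are as many conditions as
    finite sequences in [B], hence at most [kappa], by [kappa * kappa = kappa]
    ([infinite_pairing]). *)

Set Implicit Arguments.
Unset Strict Implicit.
Unset Printing Implicit Defensive.

Local Open Scope classical_set_scope.
Local Open Scope card_scope.

(** * Arithmetic of infinite cardinals *)

Lemma card_le_ex_inj (T U : Type) (u0 : U) (A : set T) (B : set U) :
  A #<= B -> exists f : T -> U, (forall x, A x -> B (f x)) /\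
    (forall x y, A x -> A y -> f x = f y -> x = y).
Proof.
elim/Ppointed: U => U in u0 B *.
  by have := set_mem (mem_set I : u0 \in setT); rewrite emptyE.
move=> /pcard_leP[f]; exists f; split=> [x Ax|x y Ax Ay]; first exact: funS.
by apply: inj; rewrite inE.
Qed.

Lemma card_le_inj (T U : Type) (A : set T) (B : set U) (f : T -> U) :
  (forall x, A x -> B (f x)) ->
  (forall x y, A x -> A y -> f x = f y -> x = y) -> A #<= B.
Proof.
move=> fAB finj; have fA : f @` A #= A.
  by apply: inj_card_eq => x y /set_mem Ax /set_mem Ay; exact: finj.
by rewrite -(card_le_eql fA); apply: subset_card_le => _ [x Ax <-]; exact: fAB.
Qed.

Section InfiniteCardinal.
Variable T : Type.
Hypothesis Tinf : [set: nat] #<= [set: T].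

(** A relation [R] satisfying [pairing_on R] is the graph of an injection from
   [A * A] to [A], where [A] is recovered from [R] as [diag R]. Working with
   graphs turns the order on partial pairings into inclusion. *)
Let diag (R : set ((T * T) * T)) : set T := [set x | exists z, R ((x, x), z)].

Let pairing_on (R : set ((T * T) * T)) := [/\
  forall p z z', R (p, z) -> R (p, z') -> z = z',
  forall p q z, R (p, z) -> R (q, z) -> p = q,
  forall x y z, R ((x, y), z) -> [/\ diag R x, diag R y & diag R z] &
  forall x y, diag R x -> diag R y -> exists z, R ((x, y), z)].

Let pairing_on_bigcup (F : set (set ((T * T) * T))) :
  F `<=` pairing_on -> total_on F subset -> pairing_on (\bigcup_(R in F) R).
Proof.
move=> FP Ftot.
have common R S : F R -> F S -> exists Q, [/\ F Q, R `<=` Q & S `<=` Q].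
  by move=> FR FS; have [RS|SR] := Ftot _ _ FR FS; [exists S|exists R]; split.
have diagS R x : F R -> diag R x -> diag (\bigcup_(R in F) R) x.
  by move=> FR [z Rz]; exists z; exists R.
split.
- move=> p z z' [R FR Rz] [S FS Sz'].
  have [Q [FQ RQ SQ]] := common _ _ FR FS.
  by have [fQ _ _ _] := FP _ FQ; exact: (fQ _ _ _ (RQ _ Rz) (SQ _ Sz')).
- move=> p q z [R FR Rz] [S FS Sz'].
  have [Q [FQ RQ SQ]] := common _ _ FR FS.
  by have [_ iQ _ _] := FP _ FQ; exact: (iQ _ _ _ (RQ _ Rz) (SQ _ Sz')).
- move=> x y z [R FR Rz]; have [_ _ dR _] := FP _ FR.
  by have [? ? ?] := dR _ _ _ Rz; split; exact: diagS FR _.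
- move=> x y [z [R FR Rz]] [z' [S FS Sz']].
  have [Q [FQ RQ SQ]] := common _ _ FR FS.
  have [_ _ _ tQ] := FP _ FQ.
  have [w Qw] := tQ x y (ex_intro _ z (RQ _ Rz)) (ex_intro _ z' (SQ _ Sz')).
  by exists w; exists Q.
Qed.

Lemma infinite_inhabited : inhabited T.
Proof.
apply: contrapT => nT; move: Tinf.
suff -> : [set: T] = set0.
  by move=> /card_le0P T0; have : [set: nat] 0%N by []; rewrite T0.
by apply/seteqP; split=> // t _; case: nT; exists.
Qed.

(** An infinite cardinal is equal to its square. Take a maximal injection from
    [A * A] to [A], with [A] a subset of [T], among those that extend a fixed
    pairing of a countable set. If the complement of [A] embeds in [A], then [T]
    embeds in [A + A], hence in [A * A] and in [A], and the pairing of [A]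
    transfers to [T]. Otherwise the complement contains a copy [A'] of [A], and
    the three remaining blocks of [(A + A') * (A + A')] fit together into [A']:
    the pairing is not maximal. *)
Lemma infinite_pairing : exists f : T -> T -> T,
  forall x y x' y', f x y = f x' y' -> x = x' /\ y = y'.
Proof.
have [t0] := infinite_inhabited.
have [e [_ einj0]] := card_le_ex_inj t0 Tinf.
have einj m n : e m = e n -> m = n by exact: einj0.
pose R0 : set ((T * T) * T) :=
  [set w | exists m n, w = ((e m, e n), e (pickle (m, n)))].
have R0P : pairing_on R0.
  have dR0 n : diag R0 (e n) by eexists; exists n, n.
  split.
  - move=> _ z z' [m [n [-> ->]]] [m' [n' [/einj -> /einj -> ->]]] //.
  - move=> p q z [m [n [-> ->]]] [m' [n' [->]]].
    by move=> /einj/(pcan_inj pickleK)[-> ->].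
  - by move=> x y z [m [n [-> -> ->]]]; split; exact: dR0.
  - move=> x y [_ [m [_ [-> _ _]]]] [_ [n [_ [-> _ _]]]].
    by eexists; exists m, n.
(* Joining [R0] to every graph makes the maximal graph contain [R0], so that its
   domain [A] has enough points to tag with. *)
have [|M [MP Mmax]] := @Zorn_bigcup _ (fun R => pairing_on (R0 `|` R)).
  move=> F FP Ftot.
  have [[R1 FR1]|F0] := pselect (F !=set0); last first.
    rewrite bigcup0 ?setU0 // => R FR; exfalso; apply: F0; by exists R.
  have -> : R0 `|` \bigcup_(R in F) R =
      \bigcup_(S in [set R0 `|` R | R in F]) S.
    apply/seteqP; split=> [w [R0w|[R FR Rw]]|w [_ [R FR <-] [R0w|Rw]]].
    - by exists (R0 `|` R1); [exists R1|left].
    - by exists (R0 `|` R); [exists R|right].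
    - by left.
    - by right; exists R.
  apply: pairing_on_bigcup => [_ [R FR <-]|_ _ [R FR <-] [S FS <-]].
    exact: FP.
  by have [RS|SR] := Ftot _ _ FR FS; [left|right]; exact: setUS.
move: MP; set R := R0 `|` M => -[Rfun Rinj Rdiag Rtot].
pose A := diag R.
have eA n : A (e n) by eexists; left; exists n, n.
have /choice[f0 f0P] : forall p : T * T, exists z, A p.1 -> A p.2 -> R (p, z).
  move=> [x y] /=.
  have [[Ax Ay]|nA] := pselect (A x /\ A y).
    by have [z Rz] := Rtot _ _ Ax Ay; exists z.
  by exists t0 => ? ?; case: nA.
pose f x y := f0 (x, y).
have fR x y : A x -> A y -> R ((x, y), f x y) by exact: (f0P (x, y)).
have fA x y : A x -> A y -> A (f x y).
  by move=> Ax Ay; have [] := Rdiag _ _ _ (fR _ _ Ax Ay).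
have finj x y x' y' : A x -> A y -> A x' -> A y' ->
    f x y = f x' y' -> x = x' /\ y = y'.
  move=> Ax Ay Ax' Ay' ff; have := fR _ _ Ax' Ay'; rewrite -ff => Rff.
  by have [-> ->] := Rinj _ _ _ (fR _ _ Ax Ay) Rff.
(* The points [e 0] and [e 1] of [A] are used as tags, through the coercion of
   booleans to natural numbers. *)
have einjb (b c : bool) : e b = e c -> b = c by move/einj; case: b; case: c.
have [[] /= Amin] := card_le_wf (fun b : bool => if b then A else ~` A)
    (inhabits true); last first.
  have [g [gA ginj]] := card_le_ex_inj t0 (Amin true).
  pose b x := `[< A x >].
  pose h x := f (e (b x)) (if b x then x else g x).
  have hA' x : A (if b x then x else g x).
    by rewrite /b; case: asboolP => // /gA.
  have hA x : A (h x) by apply: fA.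
  have hinj x y : h x = h y -> x = y.
    move=> /finj[]// /einjb; rewrite /b.
    by case: asboolP => Ax; case: asboolP => Ay // _; exact: ginj.
  exists (fun x y => f (h x) (h y)) => x y x' y' /finj[]//.
  by move=> /hinj -> /hinj ->.
have [g [gA ginj]] := card_le_ex_inj t0 (Amin false).
exfalso.
(* [c true] and [c false] enumerate [A] and its copy, and [N] extends the pairing
   to the blocks other than [A * A], indexed by the tags [b] and [b']. *)
pose c (b : bool) x := if b then x else g x.
have cinj b b' x x' : A x -> A x' -> c b x = c b' x' -> b = b' /\ x = x'.
  case: b; case: b' => //= Ax Ax'.
  - by move=> xE; have := gA _ Ax'; rewrite -xE.
  - by move=> xE; have := gA _ Ax; rewrite xE.
  - by move/ginj => ->.
have cA b x : A x -> A (c b x) -> b by case: b => //= /gA.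
pose t b b' x x' := f (f (e b) (e b')) (f x x').
have tA (b b' : bool) x x' : A x -> A x' -> A (t b b' x x').
  by move=> Ax Ax'; apply: (fA _ _ (fA _ _ (eA _) (eA _))); exact: fA.
pose N : set ((T * T) * T) := [set w | exists b b' x x',
  [/\ A x, A x', ~~ (b && b') & w = ((c b x, c b' x'), g (t b b' x x'))]].
have RNdiag x : diag (R `|` N) x <-> exists b y, A y /\ x = c b y.
  split=> [[z [Rz|]]|[[] [y [Ay ->]]]] /=.
  - by exists true, x; split=> //; exists z.
  - by move=> [b [b' [y [y' [Ay _ _ [-> _ _]]]]]]; exists b, y.
  - by have [z Rz] := Ay; exists z; left.
  - by eexists; right; exists false, false, y, y.
have RNA x y z : R ((x, y), z) -> [/\ A x, A y & A z] by exact: Rdiag.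
have RN p z z' : R (p, z) -> N (p, z') -> False.
  case: p => x y /RNA[Ax Ay _] [b [b' [u [u' [Au Au' nb [xE yE _]]]]]].
  by move: Ax Ay nb; rewrite xE yE => /(cA _ _ Au) -> /(cA _ _ Au') ->.
have RN' p q z : R (p, z) -> N (q, z) -> False.
  case: p => x y /RNA[_ _ Az] [b [b' [u [u' [Au Au' nb [_ zE]]]]]].
  by move: Az; rewrite zE; apply: gA; exact: tA.
apply: (Mmax (M `|` N)).
  split; first by move=> ?; left.
  move=> MN; have /MN Mg : (M `|` N)
      ((g (e 0), g (e 0)), g (t false false (e 0) (e 0))).
    by right; exists false, false, (e 0), (e 0).
  by have [Ag _ _] := RNA _ _ _ (or_intror Mg); exact: (gA _ (eA 0)) Ag.
rewrite setUA -/R; split.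
- move=> p z z' [Rz|Nz] [Rz'|Nz'].
  + exact: Rfun Rz Rz'.
  + by case: (RN _ _ _ Rz Nz').
  + by case: (RN _ _ _ Rz' Nz).
  + case: Nz Nz' => b [b' [x [x' [Ax Ax' _ [-> ->]]]]].
    move=> [d [d' [y [y' [Ay Ay' _ [/cinj + /cinj + ->]]]]]].
    by move=> /(_ Ax Ay)[-> ->] /(_ Ax' Ay')[-> ->].
- move=> p q z [Rz|Nz] [Rz'|Nz'].
  + exact: Rinj Rz Rz'.
  + by case: (RN' _ _ _ Rz Nz').
  + by case: (RN' _ _ _ Rz' Nz).
  + case: Nz Nz' => b [b' [x [x' [Ax Ax' _ [-> ->]]]]].
    move=> [d [d' [y [y' [Ay Ay' _ [-> /ginj]]]]]].
    move=> /(_ (tA _ _ _ _ Ax Ax') (tA _ _ _ _ Ay Ay')).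
    move=> /finj[]; try by [apply: fA | apply: tA].
    by move=> /finj[]// /einjb -> /einjb -> /finj[]// -> ->.
- move=> x y z [/RNA[Ax Ay Az]|].
    by split; apply/RNdiag; [exists true, x|exists true, y|exists true, z].
  move=> [b [b' [u [u' [Au Au' _ [-> -> ->]]]]]].
  split; apply/RNdiag; [by exists b, u|by exists b', u'|].
  by exists false, (t b b' u u'); split=> //; exact: tA.
- move=> x y /RNdiag[b [u [Au ->]]] /RNdiag[b' [u' [Au' ->]]].
  have [/andP[-> ->]|nb] := boolP (b && b').
    by exists (f u u'); left; exact: fR.
  by eexists; right; exists b, b', u, u'.
Qed.

(** A sequence is coded by its size and by the iterated pairing of its items. *)
Lemma card_le_seq : [set: seq T] #<= [set: T].
Proof.
have [t0] := infinite_inhabited.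
have [f finj] := infinite_pairing.
have [e [_ einj]] := card_le_ex_inj t0 Tinf.
apply: (@card_le_inj _ _ _ _ (fun s => f (e (size s)) (foldr f t0 s))) => //.
move=> s s' _ _ /finj[/einj sz].
have {}sz := sz I I.
by elim: s s' sz => [|x s IHs] [|y s'] //= [/IHs sE] /finj[-> /sE ->].
Qed.

Lemma card_le_bigcup (I U : Type) (D : set I) (F : I -> set U) :
  D #<= [set: T] -> (forall i, D i -> F i #<= [set: T]) ->
  \bigcup_(i in D) F i #<= [set: T].
Proof.
have [t0] := infinite_inhabited.
have [f finj] := infinite_pairing.
move=> /(card_le_ex_inj t0)[d [_ dinj]] FT.
have /choice[h hinj] : forall i, exists h : U -> T, D i ->
    forall x y, F i x -> F i y -> h x = h y -> x = y.
  move=> i; have [Di|nDi] := pselect (D i); last by exists (fun=> t0).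
  by have [h [_ hinj]] := card_le_ex_inj t0 (FT _ Di); exists h.
have [[u [i0 _ _]]|U0] := pselect (\bigcup_(i in D) F i !=set0); last first.
  have -> : \bigcup_(i in D) F i = set0 by exact/nonemptyPn.
  exact: card_ge0.
have /choice[k kP] : forall x, exists i,
    (\bigcup_(i in D) F i) x -> D i /\ F i x.
  move=> x; have [[i Di Fx]|nx] := pselect ((\bigcup_(i in D) F i) x).
    by exists i.
  by exists i0.
apply: (@card_le_inj _ _ _ _ (fun x => f (d (k x)) (h (k x) x))) => //.
move=> x y /kP[Dx Fx] /kP[Dy Fy] /finj[/dinj kE].
by rewrite -(kE Dx Dy) in Fy *; apply: hinj.
Qed.

Lemma card_le_setU (U : Type) (A B : set U) :
  A #<= [set: T] -> B #<= [set: T] -> A `|` B #<= [set: T].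
Proof.
move=> AT BT.
have -> : A `|` B = \bigcup_(b in [set: bool]) if b then A else B.
  apply/seteqP; split=> [x [Ax|Bx]|x [[] _ ?]].
  - by exists true.
  - by exists false.
  - by left.
  - by right.
apply: card_le_bigcup => [|[] _ //].
exact: card_le_trans (countableP _) Tinf.
Qed.
End InfiniteCardinal.

Lemma card_le_omega_plus (U V : Type) (A : set U) (K : set V) :
  [set: nat] #<= K -> A #<= K -> omega_plus A #<= K.
Proof.
rewrite -!(card_le_eqr (card_setT K)) => Kinf AK.
apply: card_le_setU => //.
  exact: card_le_trans (card_image_le _ _) Kinf.
exact: card_le_trans (card_image_le _ _) AK.
Qed.

(** * Compactness of finite unions of convergent sequences *)

Section Compactness.
Variable X : topologicalType.

(** Compact induction: if [A] did not satisfy the property [P], the complements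
    in [A] of the sets with property [P] would generate a proper filter, and no
    point of [A] could be a cluster point of it. *)
Lemma compact_ind (P : set X -> Prop) (A : set X) :
  P set0 -> (forall C D, P C -> P D -> P (C `|` D)) ->
  (forall C D, C `<=` D -> P D -> P C) ->
  (forall x, A x -> exists2 U, nbhs x U & P U) ->
  compact A -> P A.
Proof.
move=> P0 PU Psub Ploc Aco; apply: contrapT => nPA.
pose F : set_system X := [set Z | P (A `\` Z)].
have FF : ProperFilter F.
  split; first by rewrite /F /= setD0.
  split.
  - by rewrite /F /= setDT.
  - by move=> C D FC FD; rewrite /F /= setDIr; exact: PU.
  - by move=> C D CD; apply: Psub; exact: setDS.
have [|x [Ax Fx]] := Aco F FF; first by rewrite /F /= setDv.
have [U Ux PUx] := Ploc _ Ax.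
have [|y [nUy /nUy]] // := Fx (~` U) U _ Ux.
by rewrite /F /= setDE setCK; apply: Psub PUx; exact: subIsetr.
Qed.

(** If the limit is not a cluster point of a filter on the sequence, the filter
    contains a finite set of terms. *)
Lemma convergent_sequence_compact (C : set X) :
  convergent_sequence C -> compact C.
Proof.
move=> [u [x [ux ->]]] F FF FC; set C' := _ `|` _ in FC *.
apply: contrapT => nclus.
have [U [V [FU xV UV0]]] : exists U V, [/\ F U, nbhs x V & U `&` V = set0].
  apply: contrapT => nUV; apply: nclus; exists x; split; first by right.
  move=> U V FU xV; apply: contrapT => UV0; apply: nUV; exists U, V.
  by split=> //; exact/nonemptyPn.
have [N _ uV] := ux V xV.
have /(_ F FF) : compact (u @` `I_N) by exact/finite_compact/finite_image.
case=> [|y [[n nN <-] Fy]].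
  apply: filterS (filterI FC FU) => y [[[n _ <-]|->] Uy].
  - exists n => //=; rewrite ltnNge; apply/negP => Nn.
    have : (U `&` V) (u n) by split=> //; exact: uV.
    by rewrite UV0.
  - have : (U `&` V) x by split=> //; exact: nbhs_singleton.
    by rewrite UV0.
by apply: nclus; exists (u n); split=> //; left; exists n.
Qed.

Lemma convergent_sequence_countable (C : set X) :
  convergent_sequence C -> countable C.
Proof.
move=> [u [x [_ ->]]]; apply: card_le_setU; rewrite ?card_lexx //.
  exact: card_image_le.
exact: countable1.
Qed.

Lemma seq_hyperspace_compact (S : seq_hyperspace X) : compact (sval S).
Proof.
have [_ [F [/finite_seqP[s Fs] Fseq ->]]] := svalP S.
rewrite Fs bigcup_seq big_seq; apply: bigsetU_compact => C Cs.
by apply/convergent_sequence_compact/Fseq; rewrite Fs.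
Qed.

Lemma seq_hyperspace_countable (S : seq_hyperspace X) : countable (sval S).
Proof.
have [_ [F [Ffin Fseq ->]]] := svalP S.
apply: bigcup_countable => [|C /Fseq]; first exact: finite_set_countable.
exact: convergent_sequence_countable.
Qed.
End Compactness.

(** * Pseudobases in the hyperspace *)

Section HyperspacePseudobase.
Variable X : topologicalType.

Lemma open_vietoris_set (Us : seq (set X)) :
  [set` Us] `<=` open -> open (vietoris_set Us).
Proof. by move=> oUs; exists [set Us]; [move=> _ ->|rewrite bigcup_set1]. Qed.

Lemma vietoris_set_nbhs (W : set (seq_hyperspace X)) (S : seq_hyperspace X) :
  open W -> W S ->
  exists Us,
    [/\ [set` Us] `<=` open, vietoris_set Us S & vietoris_set Us `<=` W].
Proof.
move=> [D DD <-] [Us DUs UsS]; exists Us; split=> //; first exact: DD.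
by move=> K KUs; exists Us.
Qed.

Lemma seq_hyperspace_eq (S K : seq_hyperspace X) : sval S = sval K -> S = K.
Proof. by case: S K => [S ?] [K ?] /= SK; exact: eq_exist. Qed.

Definition included_in (V : set X) : set (seq_hyperspace X) :=
  [set K | sval K `<=` V].

Definition meeting (V : set X) : set (seq_hyperspace X) :=
  [set K | sval K `&` V !=set0].

Lemma open_included_in (V : set X) : open V -> open (included_in V).
Proof.
move=> oV; have -> : included_in V = vietoris_set [:: V].
  apply/seteqP; split=> K; last first.
    by move=> [KV _] x /KV[U /=]; rewrite inE => /eqP ->.
  move=> KV; split=> [x /KV Vx|U]; first by exists V; rewrite //= inE.
  rewrite inE => /eqP ->; have [K0 _] := svalP K.
  by case: K0 => x Kx; exists x; split=> //; exact: KV.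
by apply: open_vietoris_set => U /=; rewrite inE => /eqP ->.
Qed.

Lemma open_meeting (V : set X) : open V -> open (meeting V).
Proof.
move=> oV; have -> : meeting V = vietoris_set [:: V; setT].
  apply/seteqP; split=> K; last by case=> _; apply; rewrite inE eqxx.
  move=> KV; split=> [x _|U]; first by exists setT; rewrite //= !inE eqxx orbT.
  rewrite !inE => /orP[] /eqP -> //.
  by rewrite setIT; case: (svalP K).
apply: open_vietoris_set => U /=; rewrite !inE => /orP[] /eqP -> //.
exact: openT.
Qed.

Definition seq_union (s : seq (set X)) : set X := \bigcup_(U in [set` s]) U.
Definition seq_inter (s : seq (set X)) : set X := \bigcap_(U in [set` s]) U.

(** The weak separation of [S] from the outside, with the compactness of [S],
    forces [K] into [S]; the strong separation within [S], with the compactness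
    of [K], makes [K] exhaust [S]. *)
Lemma local_pseudobase_of_separating (S : seq_hyperspace X) (B : set (set X)) :
  B `<=` open ->
  (forall x y, ~ sval S x -> sval S y -> exists U, [/\ B U, U y & ~ U x]) ->
  (forall x y, sval S x -> sval S y -> x <> y ->
    exists U V, [/\ B U, B V, U x, V y & U `&` V = set0]) ->
  local_pseudobase S (
    [set included_in (seq_union s) | s in
      [set s | [set` s] `<=` B /\ sval S `<=` seq_union s]] `|`
    [set meeting (seq_inter s) | s in
      [set s | [set` s] `<=` B /\ sval S `&` seq_inter s !=set0]]).
Proof.
move=> Bo Bout Bin; split.
  move=> _ [[s [sB _] <-]|[s [sB _] <-]].
    by apply: open_included_in; apply: bigcup_open => U /sB/Bo.
  apply: open_meeting; rewrite /seq_inter bigcap_seq.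
  rewrite big_seq; elim/big_ind : _ => [|U V oU oV|U /sB/Bo //].
    exact: openT.
  exact: openI.
apply/seteqP; split=> [K KB|_ -> W [[s [_ sS] <-]|[s [_ sS] <-]]] //.
(* A finite cover of [S] by members of [B] missing [x] excludes [x] from [K]. *)
have KS : sval K `<=` sval S.
  move=> x; apply: contraPP => nx Kx.
  have [s [sB Ss sx]] : exists s, [/\ [set` s] `<=` B, sval S `<=` seq_union s &
      ~ seq_union s x].
    apply: (@compact_ind X (fun Z => exists s,
      [/\ [set` s] `<=` B, Z `<=` seq_union s & ~ seq_union s x])).
    - by exists [::]; split=> // -[].
    - move=> C D [s [sB Cs sx]] [t [tB Dt tx]]; exists (s ++ t); split.
      + by move=> U /=; rewrite mem_cat => /orP[/sB|/tB].
      + by move=> y [/Cs|/Dt] [U /= Us Uy]; exists U => //=;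
          rewrite mem_cat Us ?orbT.
      + by case=> U /=; rewrite mem_cat => /orP[] Us Ux; [apply: sx|apply: tx];
          exists U.
    - by move=> C D CD [s [sB Ds sx]]; exists s; split=> //;
        exact: subset_trans Ds.
    - move=> y Sy; have [U [BU Uy Ux]] := Bout _ _ nx Sy.
      exists U; first exact: open_nbhs_nbhs (conj (Bo _ BU) Uy).
      exists [:: U]; split=> [V|z Uz|[V]] /=; rewrite ?inE.
      + by move=> ->.
      + by exists U; rewrite //= inE.
      + by move=> ->.
    - exact: seq_hyperspace_compact.
  apply: sx; apply: (KB (included_in (seq_union s))) Kx.
  by left; exists s.
apply: seq_hyperspace_eq; apply/seteqP; split=> // x.
apply: contraPP => nx Kx.
(* By compactness of [K], members of [B] around [x] have a finite intersection
   that misses [K]. *)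
have [s [sB sx Ks]] : exists s, [/\ [set` s] `<=` B, seq_inter s x &
    sval K `&` seq_inter s = set0].
  apply: (@compact_ind X (fun Z => exists s,
    [/\ [set` s] `<=` B, seq_inter s x & Z `&` seq_inter s = set0])).
  - by exists [::]; split=> //; rewrite set0I.
  - move=> C D [s [sB sx Cs]] [t [tB tx Dt]]; exists (s ++ t); split.
    + by move=> U /=; rewrite mem_cat => /orP[/sB|/tB].
    + by move=> U /=; rewrite mem_cat => /orP[/sx|/tx].
    + rewrite -subset0 => y [[Cy|Dy] sty].
        by rewrite -Cs; split=> // U Us; apply: sty; rewrite /= mem_cat Us.
      by rewrite -Dt; split=> // U Us; apply: sty; rewrite /= mem_cat Us orbT.
  - move=> C D CD [s [sB sx Ds]]; exists s; split=> //.
    by rewrite -subset0 -Ds; exact: setSI.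
  - move=> y Ky; have xy : x <> y by move=> xy; apply: nx; rewrite xy.
    have [U [V [BU BV Ux Vy UV0]]] := Bin _ _ Kx (KS _ Ky) xy.
    exists V; first exact: open_nbhs_nbhs (conj (Bo _ BV) Vy).
    exists [:: U].
    split=> [W|W|] /=; rewrite ?inE; [by move=> ->|by move=> ->|].
    rewrite -subset0 -UV0 => z [Vz sz]; split=> //.
    by apply: sz; rewrite /= inE.
  - exact: seq_hyperspace_compact.
have [|y] := KB (meeting (seq_inter s)); last by rewrite Ks.
by right; exists s => //; split=> //; exists x.
Qed.

(** As [S] is countable, the pseudobases at its points and the disjoint open sets
    around its pairs of distinct points form a family no larger than [T], which
    satisfies the hypotheses of [local_pseudobase_of_separating]. *)
Lemma seq_hyperspace_pseudobase (T : Type) (S : seq_hyperspace X) :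
  hausdorff_space X -> [set: nat] #<= [set: T] ->
  (forall x : X, exists G, local_pseudobase x G /\ G #<= [set: T]) ->
  exists G, local_pseudobase S G /\ G #<= [set: T].
Proof.
move=> hX Tinf /choice[G GP].
have ST : sval S #<= [set: T].
  exact: card_le_trans (seq_hyperspace_countable S) Tinf.
have /choice[W WP] : forall p : X * X, exists W : set X * set X, p.1 <> p.2 ->
    [/\ open W.1, open W.2, W.1 p.1, W.2 p.2 & W.1 `&` W.2 = set0].
  move=> [x y] /=.
  have [xy|/eqP] := pselect (x = y); first by exists (set0, set0).
  move: hX; rewrite open_hausdorff => /(_ x y)/[apply].
  by move=> [W [/set_mem ? /set_mem ?] [? ? /eqP ?]]; exists W.
pose D := \bigcup_(x in sval S)
  ([set (x, y) | y in sval S] `&` [set p | p.1 <> p.2]).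
pose B := (\bigcup_(x in sval S) G x) `|`
  ([set (W p).1 | p in D] `|` [set (W p).2 | p in D]).
have DT : D #<= [set: T].
  apply: card_le_bigcup => // x _.
  apply: card_le_trans (subset_card_le (@subIsetl _ _ _)) _.
  exact: card_le_trans (card_image_le _ _) ST.
have BT : B #<= [set: T].
  apply: card_le_setU => //.
    by apply: card_le_bigcup => // x _; have [] := GP x.
  by apply: card_le_setU => //; exact: card_le_trans (card_image_le _ _) DT.
eexists; split.
  apply: (@local_pseudobase_of_separating S B).
  - move=> U [[x _ GU]|[[p [_ _ [_ /WP[? ? _ _ _]]] <-]|]] //; last first.
      by move=> [p [_ _ [_ /WP[? ? _ _ _]]] <-].
    by have [[Go _] _] := GP x; exact: Go.
  - move=> x y nSx Sy; have [[_ Gy] _] := GP y.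
    have : ~ (\bigcap_(U in G y) U) x.
      by rewrite Gy => xy; apply: nSx; rewrite xy.
    move=> /existsNP[U /not_implyP[GU Ux]].
    exists U; split=> //; first by left; exists y.
    have : (\bigcap_(U in G y) U) y by rewrite Gy.
    exact.
  - move=> x y Sx Sy xy; have [_ _ Wx Wy W0] := WP (x, y) xy.
    have Dxy : D (x, y) by exists x => //; split=> //; exists y.
    exists (W (x, y)).1, (W (x, y)).2; split=> //; right; [left|right];
      by exists (x, y).
have seqT (P : set (seq (set X))) :
    P `<=` [set s | [set` s] `<=` B] -> P #<= [set: T].
  move=> PB.
  have [t0] := infinite_inhabited Tinf.
  have [f [_ finj]] := card_le_ex_inj t0 BT.
  apply: card_le_trans (card_le_seq Tinf).
  apply: (@card_le_inj _ _ _ _ (map f)) => // s t /PB + /PB.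
  elim: s t => [|U s IHs] [|V t] //= sB tB [fUV fst].
  have -> : U = V by apply: finj fUV; [apply: sB|apply: tB]; exact: mem_head.
  rewrite (IHs t) // => Z Zs; [apply: sB|apply: tB];
    by rewrite /= in_cons Zs orbT.
apply: card_le_setU => //; apply: card_le_trans (card_image_le _ _) _;
  by apply: seqT => s [].
Qed.

Lemma convergent_sequence1 (x : X) : convergent_sequence [set x].
Proof.
exists (fun=> x), x; split; first exact: cvg_cst.
by apply/seteqP; split=> y; [right|case=> // -[]].
Qed.

Definition singleton_sequence (x : X) : seq_hyperspace X.
Proof.
exists [set x]; split; first by exists x.
exists [set [set x]]; split=> //; last by rewrite bigcup_set1.
by move=> _ ->; exact: convergent_sequence1.
Defined.

(** The traces on [X] of basic open sets inside the members of [G]: a point [y]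
    in all of them yields a singleton [{y}] in all members of [G]. *)
Lemma pseudobase_of_singleton (x : X) (G : set (set (seq_hyperspace X))) :
  local_pseudobase (singleton_sequence x) G ->
  exists H, local_pseudobase x H /\ H #<= G.
Proof.
move=> [Go Gx].
have /choice[h hP] : forall U, exists V, G U ->
    [/\ open V, V x & forall y, V y -> U (singleton_sequence y)].
  move=> U; have [GU|nGU] := pselect (G U); last by exists set0.
  have : (\bigcap_(U in G) U) (singleton_sequence x) by rewrite Gx.
  move=> /(_ U GU)/(vietoris_set_nbhs (Go _ GU))[Us [oUs [xU Ux] UsU]].
  have Vx V : V \in Us -> V x by move/Ux => [_ [->]].
  exists (\bigcap_(V in [set` Us]) V); split=> [|//|y Vy].
    rewrite bigcap_seq big_seq; elim/big_ind : _ => [|V V' oV oV'|V /oUs //].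
      exact: openT.
    exact: openI.
  apply: UsU; split=> [_ ->|V VUs]; last by exists y; split=> //; exact: Vy.
  by have [V VUs _] := xU x erefl; exists V => //; exact: Vy.
exists [set h U | U in G]; split; last exact: card_image_le.
split=> [_ [U /hP[? _ _] <-] //|].
apply/seteqP; split=> [y yh|_ -> _ [U /hP[_ ? _] <-] //].
have : (\bigcap_(U in G) U) (singleton_sequence y).
  by move=> U GU; have [_ _] := hP _ GU; apply; apply: yh; exists U.
rewrite Gx => /(congr1 sval)/= yx.
by have : [set y] y by []; rewrite yx.
Qed.
End HyperspacePseudobase.

(** * Bounds on the pseudocharacter *)

Section Pseudocharacter.
Variable Y : topologicalType.

Lemma pseudocharacter_infinite (y : Y) : [set: nat] #<= pseudocharacter Y.
Proof.
apply: (card_le_trans _ ((sup_cardP _).1 (pseudocharacter_at y) _)) => //.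
by apply: (@card_le_inj _ _ _ _ inl) => [n _|m n _ _ [->]] //; left; exists n.
Qed.

Lemma pseudobase_le_pseudocharacter (y : Y) :
  local_pseudobase y !=set0 ->
  exists G, local_pseudobase y G /\ G #<= pseudocharacter Y.
Proof.
move=> /min_cardP[yG _]; eexists; split; first exact: yG.
apply: (card_le_trans _ ((sup_cardP _).1 (pseudocharacter_at y) _)) => //.
by apply: (@card_le_inj _ _ _ _ inr) => [U GU|U V _ _ [->]] //; right; exists U.
Qed.

Lemma pseudocharacter_le (V : Type) (K : set V) :
  (forall y : Y, [set: nat] #<= K /\
    exists G, local_pseudobase y G /\ G #<= K) ->
  pseudocharacter Y #<= K.
Proof.
move=> YK; apply: sup_card_le => _ [y _ <-].
have [Kinf [G [yG GK]]] := YK y.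
apply: card_le_omega_plus => //.
have [_ Gmin] := min_cardP (ex_intro _ G yG).
exact: card_le_trans (Gmin _ yG) GK.
Qed.
End Pseudocharacter.

Theorem theorem4p3 (X : topologicalType) (hX : hausdorff_space X) :
  pseudocharacter (seq_hyperspace X) #= pseudocharacter X.
Proof.
have XG (x : X) : exists G, local_pseudobase x G /\ G #<= pseudocharacter X.
  apply/pseudobase_le_pseudocharacter/local_pseudobase_neq0.
  exact: hausdorff_accessible.
have SG (S : seq_hyperspace X) : [set: nat] #<= pseudocharacter X /\
    exists G, local_pseudobase S G /\ G #<= pseudocharacter X.
  have [[x _] _] := svalP S.
  have Xinf := pseudocharacter_infinite x; split=> //.
  have KT := card_le_eqr (card_setT (pseudocharacter X)).
  have [|y|G [SG GK]] := @seq_hyperspace_pseudobase X (pseudocharacter X) S hX.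
  - by rewrite KT.
  - by have [G [yG GK]] := XG y; exists G; rewrite KT.
  - by exists G; rewrite -KT.
apply/card_eqPle; split; apply: pseudocharacter_le => // x.
split; first exact: (pseudocharacter_infinite (singleton_sequence x)).
have [_ [G [xG _]]] := SG (singleton_sequence x).
have [H [xH HK]] := pseudobase_le_pseudocharacter (ex_intro _ G xG).
have [I [xI IH]] := pseudobase_of_singleton xH.
by exists I; split=> //; exact: card_le_trans IH HK.
Qed.
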